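(* Let $f\in\mathbb{R}[X_1,\ldots,X_n]$ be a polynomial with $f(\mathbf{0})=0$ such that $\mathbf{0}$ is an isolated real critical point of $f$. Suppose $R>0$ is a faithful radius of $\mathbf{0}$, and let $f_R^{\min}=\min\{f(x)\mid x\in \mathsf{B}_R\}$ and $f_R^{\max}=\max\{f(x)\mid x\in \mathsf{B}_R\}$. Then: (1) $\mathbf{0}$ is a local minimizer of $f$ if and only if $f_R^{\max}>0$ and $f_R^{\min}=0$; (2) $\mathbf{0}$ is a local maximizer of $f$ if and only if $f_R^{\max}=0$ and $f_R^{\min}<0$; (3) $\mathbf{0}$ is a saddle point of $f$ if and only if $f_R^{\max}>0$ and $f_R^{\min}<0$.
   Context: For $r>0$, $\mathsf{B}_r=\{x\in\mathbb{R}^n\mid \|x\|_2\le r\}$ (Euclidean norm). $\mathrm{Crit}_{\mathbb{R}}(f)=\{x\in\mathbb{R}^n\mid \nabla f(x)=\mathbf{0}\}$; $\mathbf{0}$ is an isolated real critical point if it is the only real critical point in some neighborhood of itself. The tangency variety is $\Gamma_{\mathbb{R}}(f)=\{x\in\mathbb{R}^n\mid \exists\lambda\in\mathbb{R}\text{ with }\nabla f(x)=\lambda x\}$, and $\mathbf{V}_{\mathbb{R}}(f)=\{x\in\mathbb{R}^n\mid f(x)=0\}$. A real $R>0$ is an isolation radius of $\mathbf{0}$ if $\mathrm{Crit}_{\mathbb{R}}(f)\cap\mathsf{B}_R=\{\mathbf{0}\}$. An isolation radius $R$ is a faithful radius of $\mathbf{0}$ if (i) $\Gamma_{\mathbb{R}}(f)\cap\mathsf{B}_R$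 is connected and (ii) $\Gamma_{\mathbb{R}}(f)\cap\mathbf{V}_{\mathbb{R}}(f)\cap\mathsf{B}_R=\{\mathbf{0}\}$. A saddle point is a critical point that is neither a local minimizer nor a local maximizer. *)

(* Defs.v *)
From mathcomp Require Import all_boot all_order all_algebra.
(* mpoly is not imported: its notations clash with those of mathcomp-analysis. *)
From mathcomp Require mpoly.
From mathcomp Require Import all_classical all_reals all_analysis.
Set Implicit Arguments.
Unset Strict Implicit.
Unset Printing Implicit Defensive.
Import Order.TTheory GRing.Theory Num.Theory.
Import numFieldNormedType.Exports.
Local Open Scope classical_set_scope.
Local Open Scope ring_scope.

Section Definitions.
Variables (R : realType) (n : nat).
Implicit Types (f : mpoly.mpoly n R) (x : 'rV[R]_n) (r : R).

Definition peval f x : R := mpoly.meval (fun i => x ord0 i) f.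

Definition grad f x : 'rV[R]_n := \row_i peval (mpoly.mderiv i f) x.

(* The library norm on row vectors is the sup norm (it induces the same
   topology), hence the explicit Euclidean norm. *)
Definition norm2 x : R := Num.sqrt (\sum_i x ord0 i ^+ 2).

Definition cball2 r : set 'rV[R]_n := [set x | norm2 x <= r].

Definition Crit f : set 'rV[R]_n := [set x | grad f x = 0].

Definition tangency_variety f : set 'rV[R]_n :=
  [set x | exists lambda : R, grad f x = lambda *: x].

Definition zero_set f : set 'rV[R]_n := [set x | peval f x = 0].

Definition isolation_radius f r : Prop :=
  0 < r /\ Crit f `&` cball2 r = [set 0].

Definition faithful_radius f r : Prop :=
  [/\ isolation_radius f r,
      connected (tangency_variety f `&` cball2 r) &
      tangency_variety f `&` zero_set f `&` cball2 r = [set 0]].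

Definition local_minimizer f x : Prop :=
  \forall y \near x, peval f x <= peval f y.

Definition local_maximizer f x : Prop :=
  \forall y \near x, peval f y <= peval f x.

Definition saddle_point f x : Prop :=
  [/\ Crit f x, ~ local_minimizer f x & ~ local_maximizer f x].

(* The least (greatest) element of A; it defaults to 0 when there is none. *)
Definition set_min (A : set R) : R := xget 0 (A `&` lbound A).
Definition set_max (A : set R) : R := xget 0 (A `&` ubound A).

Definition ball_min f r : R := set_min (peval f @` cball2 r).
Definition ball_max f r : R := set_max (peval f @` cball2 r).

End Definitions.

(* Main.v *)
(* Let m be the minimum of f on the ball B_r. If m < 0, a minimizer x is nonzero,
   and first-order conditions on the ball make grad f x a multiple of x, so x
   lies on the tangency variety. If moreover 0 is a local minimizer, then on the
   part of this variety in B_r, where f vanishes only at 0, the set {f < 0} is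
   clopen, nonempty and misses 0, against connectedness. Hence 0 is a local
   minimizer iff m = 0, and dually for maximizers. Both extrema cannot vanish:
   every nonzero point of B_r would be a minimizer, hence a zero of f on the
   tangency variety. *)
Require Import Defs.
From mathcomp Require Import all_boot all_order all_algebra.
From mathcomp Require mpoly.
From mathcomp Require Import all_classical all_reals all_analysis.
From mathcomp Require Import ring lra.
Set Implicit Arguments.
Unset Strict Implicit.
Unset Printing Implicit Defensive.
Import Order.TTheory GRing.Theory Num.Theory.
Import numFieldNormedType.Exports.
Local Open Scope classical_set_scope.
Local Open Scope ring_scope.
(* The notations of mpoly clash with those of mathcomp-analysis. *)
Import (canonicals) mpoly.

(** Constants and variables generate the polynomial algebra. This form of induction suits properties
    stable under sums and products, such as continuity and expansion along a line. *)
Lemma mpoly_alg_ind (R : comNzRingType) (n : nat)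
    (P : mpoly.mpoly n R -> Prop) :
  (forall c, P (mpoly.mpolyC n c)) ->
  (forall i, P (mpoly.mpolyX R (mpoly.mnm1 i))) ->
  (forall p q, P p -> P q -> P (p + q)) ->
  (forall p q, P p -> P q -> P (p * q)) ->
  forall p, P p.
Proof.
move=> PC PX PD PM; elim/mpoly.mpolyind => [|c m p _ _ Pp].
  by rewrite -mpoly.mpolyC0; exact: PC.
apply: (PD) => //; rewrite -mpoly.mul_mpolyC; apply: (PM) => //.
rewrite mpoly.mpolyXE_id; apply: big_ind => [|//|i _].
  by rewrite -mpoly.mpolyC1; exact: PC.
elim: (mpoly.fun_of_multinom m i) => [|k IH].
  by rewrite expr0 -mpoly.mpolyC1; exact: PC.
by rewrite exprS; exact: PM.
Qed.

(** * Euclidean inner product and topology of Euclidean balls *)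

Section DotProduct.
Variables (R : realType) (n : nat).
Implicit Types (x y z : 'rV[R]_n) (a r : R).

Definition dot x y : R := \sum_i x ord0 i * y ord0 i.

Lemma dotC x y : dot x y = dot y x.
Proof. by apply: eq_bigr => i _; rewrite mulrC. Qed.

Lemma dotDl x y z : dot (x + y) z = dot x z + dot y z.
Proof.
by rewrite /dot -big_split; apply: eq_bigr => i _; rewrite mxE mulrDl.
Qed.

Lemma dotZl a x y : dot (a *: x) y = a * dot x y.
Proof.
by rewrite /dot mulr_sumr; apply: eq_bigr => i _; rewrite mxE mulrA.
Qed.

Lemma dotDr x y z : dot z (x + y) = dot z x + dot z y.
Proof. by rewrite dotC dotDl !(dotC _ z). Qed.

Lemma dotZr a x y : dot y (a *: x) = a * dot y x.
Proof. by rewrite dotC dotZl dotC. Qed.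

Lemma dotxx_ge0 x : 0 <= dot x x.
Proof. by apply: sumr_ge0 => i _; rewrite -expr2 sqr_ge0. Qed.

Lemma dotxx_eq0 x : (dot x x == 0) = (x == 0).
Proof.
apply/idP/eqP => [|->]; last by rewrite /dot big1 // => i _; rewrite mxE mul0r.
rewrite psumr_eq0 => [/allP x0|i _]; last by rewrite -expr2 sqr_ge0.
apply/rowP => i; rewrite mxE; apply/eqP.
by have := x0 i; rewrite mem_index_enum mulf_eq0 orbb => /(_ isT).
Qed.

Lemma dotxx_gt0 x : (0 < dot x x) = (x != 0).
Proof. by rewrite lt0r dotxx_eq0 dotxx_ge0 andbT. Qed.

Lemma norm2E x : norm2 x = Num.sqrt (dot x x).
Proof. by congr Num.sqrt; apply: eq_bigr => i _; rewrite expr2. Qed.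

Lemma norm20 : norm2 (0 : 'rV[R]_n) = 0.
Proof. by rewrite norm2E (eqP (_ : dot 0 0 == 0)) ?sqrtr0// dotxx_eq0. Qed.

Lemma cball2_0 r : 0 <= r -> cball2 r (0 : 'rV[R]_n).
Proof. by rewrite /cball2 /= norm20. Qed.

(** Carries boundedness over from the Euclidean norm to the sup norm, for the compactness of
    balls. *)
Lemma mx_norm_le_norm2 x : `|x| <= norm2 x.
Proof.
rewrite [`|x|]mx_normrE; apply: bigmax_le => [|[i j] _]; first exact: sqrtr_ge0.
rewrite /= (ord1 i) -sqrtr_sqr ler_wsqrtr// (bigD1 j)//= lerDl.
by apply: sumr_ge0 => k _; rewrite sqr_ge0.
Qed.

Lemma norm2_continuous : continuous (@norm2 R n).
Proof.
move=> x; apply: (@continuous_comp _ _ _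
  (fun y : 'rV[R]_n => \sum_i y ord0 i ^+ 2) Num.sqrt); last first.
  exact: sqrt_continuous.
apply: continuous_big => [|i _ y]; first exact: add_continuous.
apply: (@continuous_comp _ R R (fun z : 'rV[R]_n => z ord0 i) (fun t => t ^+ 2)).
  exact: coord_continuous.
exact: exprn_continuous.
Qed.

Lemma closed_cball2 r : closed (@cball2 R n r).
Proof.
apply: (@preimage_closed _ _ (@norm2 R n) [set y | y <= r]).
  by move=> x _; exact: norm2_continuous.
exact: closed_le.
Qed.

Lemma compact_cball2 r : compact (@cball2 R n r).
Proof.
apply: bounded_closed_compact; last exact: closed_cball2.
exists r; split; first exact: num_real.
move=> M rM x xr; apply: le_trans (mx_norm_le_norm2 x) _.
exact: le_trans xr (ltW rM).
Qed.

Lemma nbhs0_cball2 r : 0 < r -> nbhs (0 : 'rV[R]_n) (cball2 r).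
Proof.
move=> r0; have : nbhs (norm2 (0 : 'rV[R]_n)) [set y : R | y <= r].
  rewrite norm20; apply: filterS (open_nbhs_nbhs (conj (@open_lt R r) r0)).
  by move=> y; exact: ltW.
exact: norm2_continuous.
Qed.

End DotProduct.

(** * Expansion of polynomials along lines and first-order conditions *)

Section Evaluation.
Variables (R : realType) (n : nat).
Implicit Types (f g : mpoly.mpoly n R) (x v : 'rV[R]_n) (r : R).

Lemma pevalN f x : peval (- f) x = - peval f x.
Proof. exact: mpoly.mevalN. Qed.

Lemma gradN f x : grad (- f) x = - grad f x.
Proof. by apply/rowP => i; rewrite !mxE mpoly.mderivN pevalN. Qed.

Lemma peval_continuous f : continuous (peval f).
Proof.
elim/mpoly_alg_ind: f => [c|i|p q cp cq|p q cp cq] x.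
- have -> : peval (mpoly.mpolyC n c) = cst c.
    by apply/funext => y; exact: mpoly.mevalC.
  exact: cst_continuous.
- have -> : peval (mpoly.mpolyX R (mpoly.mnm1 i)) = fun y => y ord0 i.
    by apply/funext => y; exact: mpoly.mevalXU.
  exact: coord_continuous.
- have -> : peval (p + q) = peval p \+ peval q.
    by apply/funext => y; exact: mpoly.mevalD.
  exact: (cvgD (cp x) (cq x)).
- have -> : peval (p * q) = peval p \* peval q.
    by apply/funext => y; exact: mpoly.mevalM.
  exact: (cvgM (cp x) (cq x)).
Qed.

(** First-order Taylor expansion with a polynomial remainder, obtained algebraically by induction on
    [f]. *)
Lemma peval_line f x v : exists q : {poly R}, forall t,
  peval f (x + t *: v) = peval f x + t * dot (grad f x) v + t ^+ 2 * q.[t].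
Proof.
elim/mpoly_alg_ind: f => [c|i|f g [p Hp] [q Hq]|f g [p Hp] [q Hq]].
- exists 0 => t; rewrite horner0 mulr0 addr0.
  rewrite (_ : dot _ _ = 0) ?mulr0 ?addr0 ?/peval ?mpoly.mevalC//.
  by apply: big1 => i _; rewrite mxE mpoly.mderivC /peval mpoly.meval0 mul0r.
- exists 0 => t; rewrite horner0 mulr0 addr0 /peval !mpoly.mevalXU !mxE.
  congr (_ + _ * _); rewrite /dot (bigD1 i)//= big1 ?addr0 => [|j ji].
    rewrite mxE /peval mpoly.mderivX mpoly.mnm1E eqxx scale1r.
    rewrite (_ : mpoly.mnm_sub _ _ = mpoly.mnm0).
      by rewrite mpoly.mpolyX0 mpoly.meval1 mul1r.
    by apply/mpoly.mnmP => k; rewrite mpoly.mnmBE mpoly.mnm0E subnn.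
  rewrite mxE /peval mpoly.mderivX mpoly.mnm1E eq_sym (negbTE ji).
  by rewrite scale0r mpoly.meval0 mul0r.
- exists (p + q) => t; rewrite hornerD.
  have -> : dot (grad (f + g) x) v = dot (grad f x) v + dot (grad g x) v.
    rewrite -dotDl; congr dot; apply/rowP => i.
    by rewrite !mxE mpoly.mderivD /peval mpoly.mevalD.
  rewrite /peval !mpoly.mevalD -!/(peval _ _) Hp Hq; ring.
- set a := dot (grad f x) v; set b := dot (grad g x) v.
  (* What remains of the product of the two expansions, divided by [t ^+ 2], once its terms of
     degree 0 and 1 are removed. *)
  exists ((a * b)%:P + peval f x *: q + peval g x *: p
          + 'X * (a *: q + b *: p) + 'X^2 * p * q) => t.
  have -> : dot (grad (f * g) x) v = a * peval g x + peval f x * b.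
    rewrite [a * _]mulrC /a /b -!dotZl -dotDl; congr dot; apply/rowP => i.
    rewrite !mxE mpoly.mderivM /peval mpoly.mevalD !mpoly.mevalM -!/(peval _ _)
      -!/(peval _ x); ring.
  rewrite !hornerE /peval !mpoly.mevalM -!/(peval _ _) Hp Hq
    -/a -/b; ring.
Qed.

(** With a negative slope, the linear term would dominate the quadratic remainder for small [t], and
    [f] would decrease. *)
Lemma dot_grad_ge0 f x v (e : R) : 0 < e ->
  (forall t, 0 < t < e -> peval f x <= peval f (x + t *: v)) ->
  0 <= dot (grad f x) v.
Proof.
move=> e0 fx; have [q Hq] := peval_line f x v.
set a := dot _ _ in Hq *; rewrite leNgt; apply/negP => a0.
have [M HM] := poly_disk_bound q 1.
have M0 : 0 <= M by apply: le_trans (HM 0 _); rewrite ?normr0.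
(* The three bounds keep [t] below [e], keep [t] where [M] bounds [q], and make [a + t * q.[t]]
   negative. *)
pose t := Num.min (e / 2) (Num.min 1 (- a / (M + 1))).
have t0 : 0 < t by rewrite !lt_min ltr01 !divr_gt0//= ?oppr_gt0// ltr_wpDl.
have te : t < e.
  by rewrite gt_min ltr_pdivrMr// ltr_pMr// ltr1n.
have t1 : t <= 1 by rewrite !ge_min lexx orbT.
have ta : t * (M + 1) <= - a.
  by rewrite -ler_pdivlMr ?ltr_wpDl// !ge_min lexx !orbT.
have /fx : 0 < t < e by rewrite t0 te.
rewrite Hq -addrA lerDl expr2 -mulrA -mulrDr pmulr_rge0// leNgt => /negP; apply.
have : q.[t] <= M by apply: le_trans (ler_norm _) (HM _ _); rewrite gtr0_norm.
nra.
Qed.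

(** The squared norm changes by [t * (2 * dot x v + t * dot v v)], and the bound on [t] gives
    [t * dot v v < - dot x v]. *)
Lemma norm2_line_le x v t : dot x v < 0 ->
  0 < t < - dot x v / (dot v v + 1) -> norm2 (x + t *: v) <= norm2 x.
Proof.
move=> xv /andP[t0]; rewrite ltr_pdivlMr ?ltr_wpDl ?dotxx_ge0// => tv.
rewrite !norm2E ler_wsqrtr// !(dotDl, dotDr, dotZl, dotZr) (dotC v x).
by have := dotxx_ge0 v; nra.
Qed.

(* Moving from x in a direction v with <x, v> < 0 stays in the ball, so
   <grad f x, v> >= 0 there: grad f x is a multiple of x, whether x is interior
   or not. *)
Lemma ball_minimizer_tangency f r x : x != 0 -> cball2 r x ->
  (forall y, cball2 r y -> peval f x <= peval f y) -> tangency_variety f x.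
Proof.
move=> x0 xr fmin; set g := grad f x.
have gv v : dot x v < 0 -> 0 <= dot g v.
  move=> xv; apply: (@dot_grad_ge0 _ _ _ (- dot x v / (dot v v + 1))).
    by rewrite divr_gt0 ?oppr_gt0// ltr_wpDl ?dotxx_ge0.
  move=> t te; apply: fmin; apply: le_trans xr; exact: norm2_line_le.
have xx0 : 0 < dot x x by rewrite dotxx_gt0.
(* The multiplier is that of the orthogonal projection of [g] on [x]; the residue [p], orthogonal to
   [x], must vanish. *)
exists (dot g x / dot x x); apply/eqP; rewrite -subr_eq0 -scaleNr.
set p := _ + _; apply: contraT; rewrite -dotxx_gt0 => p0.
have xp : dot x p = 0.
  by rewrite dotDr dotZr (dotC x g) mulNr divfK ?subrr// gt_eqF.
have gp : dot g p = dot p p.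
  by rewrite [in RHS]/p dotDl dotZl xp mulr0 addr0.
(* The direction [-p] is only tangent to the sphere, so it is tilted inward by [- e *: x], with [e]
   so small that the product with [g] stays negative. *)
pose e := dot p p / (`|dot g x| + 1).
have d0 : 0 < `|dot g x| + 1 by rewrite ltr_wpDl.
have e0 : 0 < e by rewrite divr_gt0.
have eE : e * (`|dot g x| + 1) = dot p p by rewrite divfK// gt_eqF.
have := gv (- 1 *: p + (- e) *: x).
rewrite !dotDr !dotZr xp gp mulr0 add0r mulNr oppr_lt0 mulr_gt0// => /(_ isT).
have := ler_norm (- dot g x); rewrite normrN; nra.
Qed.

End Evaluation.

(** * Extrema on a ball of faithful radius *)

Section FaithfulRadius.
Variables (R : realType) (n : nat).
Implicit Types (f : mpoly.mpoly n R) (x : 'rV[R]_n) (r : R).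

(** Negation only changes the sign of the multiplier in the tangency variety. Statements on maxima
    thus reduce to minima. *)
Lemma faithful_radiusN f r : faithful_radius f r -> faithful_radius (- f) r.
Proof.
have EC : Crit (- f) = Crit f.
  apply/seteqP; split => x; rewrite /Crit /= gradN; last by move->; rewrite oppr0.
  by move/eqP; rewrite oppr_eq0 => /eqP.
have EG : tangency_variety (- f) = tangency_variety f.
  apply/seteqP; split => x [l]; rewrite ?gradN => Hl; exists (- l).
    by rewrite scaleNr -Hl opprK.
  by rewrite gradN scaleNr Hl.
have EZ : zero_set (- f) = zero_set f.
  apply/seteqP; split => x; rewrite /zero_set /= pevalN; last by move->; rewrite oppr0.
  by move/eqP; rewrite oppr_eq0 => /eqP.
by rewrite /faithful_radius /isolation_radius EC EG EZ.
Qed.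

Lemma local_maximizerN f x : local_maximizer f x <-> local_minimizer (- f) x.
Proof.
rewrite /local_maximizer /local_minimizer.
by split; apply: filterS => y; rewrite !pevalN lerN2.
Qed.

Lemma ball_minP f r : 0 <= r -> exists2 x, cball2 r x &
  ball_min f r = peval f x /\ forall y, cball2 r y -> peval f x <= peval f y.
Proof.
move=> r0; have [|x /set_mem xr fx] := @EVT_min_rV _ _ (peval f) (cball2 r) _
    (@compact_cball2 _ _ r) (continuous_subspaceT (@peval_continuous _ _ f)).
  by exists 0; exact: cball2_0.
have xmin y : cball2 r y -> peval f x <= peval f y.
  by move=> yr; apply: fx; rewrite inE.
exists x => //; split => //.
(* The existence of the minimizer [x] rules out the default value 0. *)
rewrite /ball_min /set_min; case: xgetP => [m _ [[y yr <-] ym]|].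
  by apply/eqP; rewrite eq_le xmin// ym//; exists x.
move=> /(_ (peval f x)) []; split; first by exists x.
by move=> _ [y yr <-]; exact: xmin.
Qed.

Lemma ball_maxN f r : 0 <= r -> ball_max f r = - ball_min (- f) r.
Proof.
move=> /(ball_minP (- f))[x xr [-> fx]]; rewrite pevalN opprK.
have xmax y : cball2 r y -> peval f y <= peval f x.
  by move=> /fx; rewrite !pevalN lerN2.
rewrite /ball_max /set_max; case: xgetP => [m _ [[y yr <-] ym]|].
  by apply/eqP; rewrite eq_le xmax// ym//; exists x.
move=> /(_ (peval f x)) []; split; first by exists x.
by move=> _ [y yr <-]; exact: xmax.
Qed.

Lemma ball_min_ge0P f r : 0 <= r ->
  0 <= ball_min f r <-> forall x, cball2 r x -> 0 <= peval f x.
Proof.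
move=> /(ball_minP f)[x xr [-> fx]]; split => [f0 y yr|]; last exact.
exact: le_trans f0 (fx _ yr).
Qed.

Lemma ball_min_le0 f r : 0 <= r -> peval f 0 = 0 -> ball_min f r <= 0.
Proof.
by move=> r0 f0; have [x xr [-> fx]] := ball_minP f r0; rewrite -f0 fx//;
  exact: cball2_0.
Qed.

(* A negative minimum on the ball would be attained on the tangency variety,
   whose negative part is relatively open, relatively closed (0 being a local
   minimizer and the only zero of f there) and misses 0. *)
Lemma local_minimizer_ball_ge0 f r : peval f 0 = 0 -> faithful_radius f r ->
  local_minimizer f 0 -> forall x, cball2 r x -> 0 <= peval f x.
Proof.
move=> f0 [[r0 _] Gconn GV] fmin0.
apply/(ball_min_ge0P f (ltW r0)); have [x xr [-> xmin]] := ball_minP f (ltW r0).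
rewrite leNgt; apply/negP => fx.
have x0 : x != 0 by apply: contraTneq fx => ->; rewrite f0 ltxx.
have xG := ball_minimizer_tangency x0 xr xmin.
have [G0 B0] : (tangency_variety f `&` cball2 r) 0.
  by have : [set 0] (0 : 'rV[R]_n) by []; rewrite -GV => -[[]].
set A := _ `&` _ in Gconn.
pose B := A `&` [set y | peval f y < 0].
suff BA : B = A.
  by have : A 0 by []; rewrite -BA => -[_] /=; rewrite f0 ltxx.
have fc := @peval_continuous _ _ f.
apply: Gconn; first by exists x.
- exists [set y | peval f y < 0] => //.
  by apply: (@open_comp _ _ (peval f) [set z | z < 0]) => [y _|];
    [exact: fc|exact: open_lt].
- have : nbhs (0 : 'rV[R]_n) [set y | peval f 0 <= peval f y] := fmin0.
  rewrite nbhsE => -[U [Uo U0] Uf].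
  (* Removing [U], where [f] is nonnegative, loses no point of [B] but discards 0, the only zero of
     [f] on [A]; so [f <= 0] becomes strict. *)
  exists ([set y | peval f y <= 0] `&` ~` U).
    apply: closedI; last exact: open_closedC.
    by apply: (@preimage_closed _ _ (peval f) [set z | z <= 0]) => [y _|];
      [exact: fc|exact: closed_le].
  rewrite /B; apply/seteqP; split => y [Ay] /= => [fy|[fy Uy]]; split => //.
    by split; [exact: ltW|move=> /Uf /=; rewrite f0 leNgt fy].
  rewrite lt_neqAle fy andbT; apply/eqP => fy0; apply: Uy.
  have : (tangency_variety f `&` zero_set f `&` cball2 r) y.
    by case: Ay.
  by rewrite GV => ->.
Qed.

Lemma local_minimizer_ball_minP f r :
  peval f 0 = 0 -> faithful_radius f r ->
  local_minimizer f 0 <-> ball_min f r = 0.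
Proof.
move=> f0 fr; have [[r0 _] _ _] := fr; have r0' := ltW r0; split => [lf|m0].
  apply/eqP; rewrite eq_le ball_min_le0//=; apply/ball_min_ge0P => //.
  exact: local_minimizer_ball_ge0.
have fge0 : forall x, cball2 r x -> 0 <= peval f x.
  by apply/ball_min_ge0P => //; rewrite m0.
rewrite /local_minimizer f0; apply: filterS (nbhs0_cball2 n r0) => y.
exact: fge0.
Qed.

Lemma ball_min_max_not_both0 f r : (0 < n)%N -> peval f 0 = 0 ->
  faithful_radius f r -> ball_min f r = 0 -> ball_max f r = 0 -> False.
Proof.
move=> n0 f0 [[r0 _] _ GV] m0 M0.
have r0' := ltW r0.
have fge0 : forall x, cball2 r x -> 0 <= peval f x.
  by apply/ball_min_ge0P => //; rewrite m0.
have fle0 : forall x, cball2 r x -> 0 <= peval (- f) x.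
  by apply/ball_min_ge0P => //; rewrite -oppr_le0 -ball_maxN// M0.
(* A nonzero point of the ball, on the first axis; in dimension 0 there is none, and both extrema
   vanish. *)
pose x : 'rV[R]_n := r *: delta_mx ord0 (Ordinal n0).
have xr : cball2 r x.
  rewrite /cball2 /= norm2E dotZl dotZr /dot (bigD1 (Ordinal n0))//=.
  rewrite big1 => [|i /negbTE i0]; last by rewrite mxE i0 andbF mul0r.
  by rewrite !mxE !eqxx /= mulr1 addr0 mulr1 -expr2 sqrtr_sqr gtr0_norm.
have x0 : x != 0.
  apply/eqP => /rowP/(_ (Ordinal n0)); rewrite !mxE !eqxx mulr1 => rE.
  by rewrite rE ltxx in r0.
have fx : peval f x = 0.
  by apply/eqP; rewrite eq_le fge0// andbT -oppr_ge0 -pevalN fle0.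
have : (tangency_variety f `&` zero_set f `&` cball2 r) x.
  split=> //; split => //; apply: (@ball_minimizer_tangency _ _ _ r) => //.
  by move=> y yr; rewrite fx fge0.
by rewrite GV => /eqP; rewrite (negbTE x0).
Qed.

End FaithfulRadius.

Theorem theorem3p7 (R : realType) (n : nat) (hn : (0 < n)%N)
    (f : mpoly.mpoly n R) (hf0 : peval f 0 = 0)
    (hiso : isolated (Crit f) 0)
    (r : R) (hr : faithful_radius f r) :
  [/\ local_minimizer f 0 <-> 0 < ball_max f r /\ ball_min f r = 0,
      local_maximizer f 0 <-> ball_max f r = 0 /\ ball_min f r < 0 &
      saddle_point f 0 <-> 0 < ball_max f r /\ ball_min f r < 0].
Proof.
have [[r0 _] _ _] := hr; have r0' := ltW r0.
have nf0 : peval (- f) 0 = 0 by rewrite pevalN hf0 oppr0.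
have minP := local_minimizer_ball_minP hf0 hr.
have maxP : local_maximizer f 0 <-> ball_max f r = 0.
  apply: iff_trans (local_maximizerN _ _) _.
  apply: iff_trans (local_minimizer_ball_minP nf0 (faithful_radiusN hr)) _.
  by rewrite ball_maxN//; split => /eqP;
    [move=> /eqP ->; rewrite oppr0|rewrite oppr_eq0 => /eqP].
have max_ge0 : 0 <= ball_max f r.
  by rewrite ball_maxN// oppr_ge0 ball_min_le0.
have min_le0 := ball_min_le0 r0' hf0.
have not_both0 := ball_min_max_not_both0 hn hf0 hr.
have max_gt0 : 0 < ball_max f r <-> ball_max f r <> 0.
  by rewrite lt0r max_ge0 andbT; split => /eqP.
have min_lt0 : ball_min f r < 0 <-> ball_min f r <> 0.
  by rewrite lt_neqAle min_le0 andbT; split => /eqP.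
have crit0 : Crit f 0 by case: hiso => /set_mem.
(* As the minimum is at most 0 and the maximum at least 0, strict signs mean nonvanishing, and only
   propositional reasoning is left. *)
split; [tauto|tauto|split => [[_]|?]; [tauto|split; tauto]].
Qed.
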